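(* Let $M$ be a connected matroid with circuit system $\mathcal{C}=\{C_1,\dots,C_g\}$, and let $D$ be a circuit of $M$. Then there exists a unique $S\subseteq[g]$ such that $$D=\triangle_{i\in S}C_i=\ast\{C_i:i\in S\}.$$
   Context: Matroids are on finite ground sets; $E(M)$ is the ground set and $r(M)$ the rank. A set is dependent if it is not independent. A cycle of $M$ is a subset of $E(M)$ that can be expressed as a union of circuits. The corank of $M$ is $g=|E(M)|-r(M)$. For subsets $A_1,\dots,A_k$ of a set $E$ and $S\subseteq[k]=\{1,\dots,k\}$, the unique union $\mathcal{A}_S=\ast\{A_i: i\in S\}$ is the set of elements of $E$ that belong to exactly one of the sets $A_i$, $i\in S$; and $\triangle_{i\in S}A_i$ denotes the symmetric difference of the sets $A_i$, $i\in S$. A cycle system on a matroid $M$ of corank $g$ is a collection $\mathcal{C}=\{C_1,\dots,C_g\}$ of $g$ cycles of $M$ such that for every nonempty $S\subseteq[g]$ the unique union $\mathcal{C}_S=\ast\{C_i:i\in S\}$ is dependent in $M$. A circuit system is a cycle system all of whose elements are circuits. *)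

(* Defs.v *)
From HB Require Import structures.
From mathcomp Require Import all_boot.

Set Implicit Arguments.
Unset Strict Implicit.
Unset Printing Implicit Defensive.

Section SymmetricDifference.
Variable T : finType.
Implicit Types A B : {set T}.

Definition symdiff A B : {set T} := (A :\: B) :|: (B :\: A).

Lemma in_symdiff A B x : (x \in symdiff A B) = (x \in A) (+) (x \in B).
Proof. by rewrite !inE; case: (x \in A); case: (x \in B). Qed.

Lemma symdiffA : associative symdiff.
Proof. by move=> A B C; apply/setP=> x; rewrite !in_symdiff addbA. Qed.

Lemma symdiffC : commutative symdiff.
Proof. by move=> A B; apply/setP=> x; rewrite !in_symdiff addbC. Qed.

Lemma symdiff0s : left_id set0 symdiff.
Proof. by move=> A; apply/setP=> x; rewrite in_symdiff in_set0. Qed.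

HB.instance Definition _ :=
  Monoid.isComLaw.Build {set T} set0 symdiff symdiffA symdiffC symdiff0s.

Variable I : finType.
Implicit Types (C : I -> {set T}) (S : {set I}).

Definition big_symdiff C S : {set T} := \big[symdiff/set0]_(i in S) C i.

Definition unique_union C S : {set T} :=
  [set x | #|[set i in S | x \in C i]| == 1].

End SymmetricDifference.

(* The ground set is a set [ground M] of elements of [T], not necessarily all
   of [T], so that minors of [M] are again matroids over [T]. *)
Record matroid (T : finType) := Matroid {
  ground : {set T};
  indep : {set {set T}};
  indep_ground : forall I, I \in indep -> I \subset ground;
  indep_set0 : set0 \in indep;
  indep_sub : forall I J : {set T}, I \subset J -> J \in indep -> I \in indep;
  indep_augment : forall I J, I \in indep -> J \in indep -> #|I| < #|J| ->
    exists2 x, x \in J :\: I & x |: I \in indep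
}.

Section Matroid.
Variables (T : finType) (M : matroid T).
Implicit Types A D : {set T}.

Definition rank : nat := \max_(I in indep M) #|I|.

(* The truncated subtraction is exact, since independent sets lie in the
   ground set. *)
Definition corank : nat := #|ground M| - rank.

Definition dependent A : bool := (A \subset ground M) && (A \notin indep M).

Definition circuit D : bool := minset dependent D.

Definition cycle A : Prop :=
  exists2 P : {set {set T}}, {in P, forall D, circuit D} & A = cover P.

(* As in Oxley: any two distinct elements lie in a common circuit. *)
Definition connected : Prop :=
  {in ground M &, forall x y, x != y ->
    exists D, [/\ circuit D, x \in D & y \in D]}.

(* Indexed families lose nothing here: if [C i = C j] with [i != j], then the
   unique union over [[set i; j]] is empty, hence not dependent. *)
Definition cycle_system (C : 'I_corank -> {set T}) : Prop :=
  (forall i, cycle (C i)) /\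
  (forall S : {set 'I_corank}, S != set0 -> dependent (unique_union C S)).

Definition circuit_system (C : 'I_corank -> {set T}) : Prop :=
  cycle_system C /\ forall i, circuit (C i).

End Matroid.

(* Main.v *)
Require Import Defs.
From mathcomp Require Import all_boot.

Set Implicit Arguments.
Unset Strict Implicit.
Unset Printing Implicit Defensive.

(** Let [W] be the set of all symmetric differences of the [C i]. A symmetric
    difference contains the corresponding unique union, so every nonempty member
    of [W] is dependent in [M]. Hence restricting members of [W] to the
    complement of a basis [B] is injective; both sides have [2 ^ corank M]
    elements, so it is bijective, and each [f] outside [B] has a codeword [X]
    in [W] with [X :\: B = [set f]] ([big_symdiff_fund]). In other words [W] is
    the cycle space of a binary matroid [N], of the same rank as [M], in which
    every basis of [M] is a basis; [X] is the fundamental circuit of [f] in [N],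
    and it contains the fundamental circuit of [f] in [M].

    It remains to see that a connected [M] must equal [N] (a theorem of Lucas on
    rank-preserving weak maps), which is done one codeword at a time. Let [b] be
    in [X] but not in the fundamental circuit of [f] in [M]. In the bipartite
    graph joining each outside element to the basis elements of its fundamental
    circuit in [M], connectedness provides a path from [f] to [b]
    ([reach_connected]). A path with three edges is impossible: exchanging both
    basis elements on it for both outside elements gives a basis of [M], but a
    dependent set of [N], because the sum of the two codewords of [N] involved
    avoids both removed elements ([codeword_adj_common]). A longer path becomes
    shorter when the basis is pivoted on the edge next to [b], so induction over
    all bases concludes ([codeword_adj_reach]).

    A circuit [D] is the fundamental circuit of some [f] in some basis, so [D]
    is itself in [W]: it is a symmetric difference. The corresponding unique
    union is dependent and lies inside the circuit [D], hence equals [D].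
    Uniqueness is the injectivity above. *)

(** * Bases and their exchange graphs *)

Section Bases.
Variables (T : finType) (M : matroid T).
Implicit Types (A B D I J X Y : {set T}) (b f : T).

Definition basis B : bool := (B \in indep M) && (#|B| == rank M).

Lemma card_indep I : I \in indep M -> #|I| <= rank M.
Proof. by move=> iI; rewrite /rank (bigD1 I) //= leq_maxl. Qed.

Lemma indep_extend I J : I \in indep M -> J \in indep M ->
  exists A, [/\ I \subset A, A \subset I :|: J, A \in indep M & #|J| <= #|A|].
Proof.
have [n] := ubnP (#|J| - #|I|); elim: n I => // n IHn I ltn iI iJ.
have [leJI | ltIJ] := leqP #|J| #|I|.
  by exists I; rewrite subxx subsetUl.
have [x /setDP[xJ xI] ixI] := indep_augment iI iJ ltIJ.
have [|A [sxA sA iA leA]] := IHn (x |: I) _ ixI iJ.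
  rewrite cardsU1 xI add1n; apply: leq_trans (_ : #|J| - #|I| <= n) => //.
  by rewrite ltn_sub2l.
exists A; split=> //; first exact: subset_trans (subsetUr _ _) sxA.
apply: subset_trans sA _; apply/subsetP=> y; rewrite !inE.
by case/orP=> [/orP[/eqP-> | ->] | ->]; rewrite ?xJ ?orbT.
Qed.

Lemma basis_extend I B : I \in indep M -> basis B ->
  exists A, [/\ I \subset A, A \subset I :|: B & basis A].
Proof.
move=> iI /andP[iB /eqP cB]; have [A [sIA sA iA leA]] := indep_extend iI iB.
by exists A; split=> //; rewrite /basis iA eqn_leq card_indep // -cB.
Qed.

Lemma basis_exists : exists B, basis B.
Proof.
have [|B iB eB] := @eq_bigmax_cond _ [in indep M] (fun I : {set T} => #|I|).
  by apply/card_gt0P; exists set0; apply: indep_set0.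
by exists B; rewrite /basis iB /rank eB eqxx.
Qed.

Lemma card_cobasis B : basis B -> #|ground M :\: B| = corank M.
Proof.
rewrite /corank cardsD => /andP[iB /eqP <-].
by have/setIidPr-> := indep_ground iB.
Qed.

Definition swap B b f : {set T} := f |: (B :\ b).

Definition swap2 B b b' f f' : {set T} := [set f; f'] :|: (B :\: [set b; b']).

Lemma card_swap B b f : b \in B -> f \notin B -> #|swap B b f| = #|B|.
Proof.
move=> bB fB; rewrite /swap cardsU1 (cardsD1 b B) bB.
by rewrite !inE (negPf fB) andbF.
Qed.

Lemma basis_swap B b f : basis B -> b \in B -> f \notin B ->
  swap B b f \in indep M -> basis (swap B b f).
Proof. by move=> /andP[_ cB] bB fB iS; rewrite /basis iS card_swap. Qed.

(** For a basis [B], this says that [b] lies in the fundamental circuit of [f].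
    Phrasing it through exchanges reduces circuit elimination to the
    augmentation axiom. *)
Definition adj B b f : bool :=
  [&& b \in B, f \notin B & swap B b f \in indep M].

Lemma augment_pair I J x y : I \in indep M -> J \in indep M -> #|I| < #|J| ->
  J :\: I \subset [set x; y] -> x |: I \notin indep M -> y |: I \in indep M.
Proof.
move=> iI iJ lt sub nx; have [z zJI iz] := indep_augment iI iJ lt.
have:= subsetP sub z zJI; rewrite !inE => /orP[]/eqP E; last by rewrite -E.
by rewrite -E iz in nx.
Qed.

(** The exchange graph determines a double exchange when it has exactly one
    perfect matching on the four elements, here [b f'] and [b' f]. The edge
    [b' f'] may or may not be present: augmenting [B] minus [b, b'] plus [f]
    from [swap B b f'] cannot use [b'], since [b f] is not an edge. *)
Lemma adj_exchange B b b' f f' :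
  adj B b f' -> adj B b' f -> ~~ adj B b f ->
  swap2 B b b' f f' \in indep M.
Proof.
move=> /and3P[bB f'B iJ] /and3P[b'B fB iI]; rewrite /adj bB fB /= => nbf.
have nb : b != b' by apply: contraNneq nbf => ->.
have nf : f != f' by apply: contraNneq nbf => ->.
pose I := f |: (B :\: [set b; b']).
have sI : I \subset swap B b' f.
  apply/subsetP=> x; rewrite !inE negb_or.
  by case: (x == f); case: (x == b'); case: (x == b).
have cI : #|I| < #|swap B b f'|.
  rewrite card_swap // -(card_swap b'B fB); apply: proper_card.
  apply/properP; split=> //; exists b; rewrite !inE ?eqxx ?nb ?bB ?orbT //=.
  by rewrite orbF; apply: contraNneq fB => <-.
have -> : swap2 B b b' f f' = f' |: I.
  by apply/setP=> x; rewrite !inE; case: (x == f); case: (x == f').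
apply: (augment_pair (x := b') (indep_sub sI iI) iJ cI).
  apply/subsetP=> x; rewrite !inE.
  by case: (x == b'); case: (x == f'); case: (x == b); case: (x == f);
    case: (x \in B).
suff -> : b' |: I = swap B b f by [].
apply/setP=> x; rewrite !inE; case: (eqVneq x b') => [->|]; last first.
  by case: (x == b).
by rewrite (eq_sym b' b) nb b'B !orbT.
Qed.

(** If [f] is adjacent to neither [b] nor [b'], its fundamental circuit survives
    the removal of both. *)
Lemma nonadj_swap2 B b b' f f' : B \in indep M ->
  b \in B -> b' \in B -> f \notin B -> f' \notin B -> b != b' -> f != f' ->
  ~~ adj B b f -> ~~ adj B b' f -> swap2 B b b' f f' \notin indep M.
Proof.
move=> iB bB b'B fB f'B nb nf; rewrite /adj bB b'B fB /= => nbf nb'f.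
apply/negP=> iS; pose I := f |: (B :\: [set b; b']).
have sI : I \subset swap2 B b b' f f'.
  by apply/subsetP=> x; rewrite !inE; case: (x == f); case: (x == f').
have cI : #|I| < #|B|.
  rewrite -(card_swap b'B fB); apply: proper_card; apply/properP; split.
    apply/subsetP=> x; rewrite !inE.
    by case: (x == f); case: (x == b'); case: (x == b).
  exists b; rewrite !inE ?eqxx ?nb ?bB ?orbT //= orbF.
  by apply: contraNneq fB => <-.
suff: b' |: I \in indep M.
  apply/negP; suff -> : b' |: I = swap B b f by [].
  apply/setP=> x; rewrite !inE; case: (eqVneq x b') => [->|]; last first.
    by case: (x == b).
  by rewrite (eq_sym b' b) nb b'B !orbT.
apply: (augment_pair (x := b) (indep_sub sI iS) iB cI).
  apply/subsetP=> x; rewrite !inE.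
  by case: (x == b'); case: (x == b); case: (x == f); case: (x \in B).
suff -> : b |: I = swap B b' f by [].
apply/setP=> x; rewrite !inE; case: (eqVneq x b) => [->|] /=.
  by rewrite nb bB !orbT.
by case: (x == b').
Qed.

Lemma swap_swap B b b' f f' : f' != b ->
  swap (swap B b' f') b f = swap2 B b b' f f'.
Proof.
move=> n; apply/setP=> x; rewrite !inE.
case: (eqVneq x f') => [->|_]; first by rewrite n orbT.
by case: (x == f); case: (x == b); case: (x == b').
Qed.

Lemma adj_swap B b b' f f' : b \in B -> f \notin B -> f' \notin B ->
  b != b' -> f != f' ->
  adj (swap B b' f') b f = (swap2 B b b' f f' \in indep M).
Proof.
move=> bB fB f'B nb nf; rewrite /adj swap_swap; last first.
  by apply: contraNneq f'B => ->.
by rewrite !inE nb bB (negPf nf) (negPf fB) orbT andbF.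
Qed.

(** * Distance in the exchange graph *)

(** [reach B f n] collects the elements of [B] at distance at most [2 n - 1]
    from [f] in the exchange graph. *)
Definition step B f X : {set T} :=
  [set b | adj B b f ||
           [exists f', adj B b f' && [exists c in X, adj B c f']]].

Lemma stepP B f X b :
  reflect (adj B b f \/ exists f' c, [/\ adj B b f', c \in X & adj B c f'])
          (b \in step B f X).
Proof.
rewrite inE; apply: (iffP orP) => -[abf | ]; try by left.
  case/existsP=> f' /andP[abf' /exists_inP[c cX acf']].
  by right; exists f', c.
case=> f' [c [abf' cX acf']]; right; apply/existsP; exists f'.
by rewrite abf'; apply/exists_inP; exists c.
Qed.

Lemma step_mono B f : {homo step B f : X Y / X \subset Y}.
Proof.
move=> X Y sXY; apply/subsetP=> b /stepP[abf | [f' [c [abf' cX acf']]]].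
  by apply/stepP; left.
by apply/stepP; right; exists f', c; rewrite (subsetP sXY).
Qed.

Definition reach B f n : {set T} := iter n (step B f) set0.

Lemma reach_leq B f m n : m <= n -> reach B f m \subset reach B f n.
Proof. exact: subset_iter (@step_mono B f) m n. Qed.

Lemma reach_in B f n b : b \in reach B f n -> b \in B.
Proof.
case: n => [|n]; first by rewrite inE.
by case/stepP=> [|[? [? []]]] /and3P[].
Qed.

(** Pivoting at [b1] only alters the fundamental circuits that contain [b1], so
    the part of the graph closer to [f] than [b1] is undisturbed. *)
Lemma reach_swap B f b1 f1 n : b1 \in B -> adj B b1 f1 ->
  ~~ adj B b1 f -> b1 \notin reach B f n ->
  reach B f n \subset reach (swap B b1 f1) f n.
Proof.
move=> b1B a11 n1; have keep x f' : adj B x f' -> ~~ adj B b1 f' ->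
    adj (swap B b1 f1) x f'.
  move=> axf n1f; have /and3P[xB fB _] := axf.
  have /and3P[_ f1B _] := a11.
  rewrite adj_swap //; first last.
  - by apply: contraNneq n1f => ->.
  - by apply: contraNneq n1f => <-.
  rewrite /swap2 (setUC [set x]); exact: adj_exchange a11 axf n1f.
elim: n => [|n IHn] nb1; first exact: sub0set.
have nb1n : b1 \notin reach B f n.
  by apply: contra nb1; apply/subsetP/reach_leq.
apply/subsetP=> x /stepP[axf | [f' [c [axf' cR acf']]]].
  by apply/stepP; left; apply: keep.
have n1f' : ~~ adj B b1 f'.
  by apply: contra nb1 => a1; apply/stepP; right; exists f', c.
by apply/stepP; right; exists f', c; rewrite !keep // (subsetP (IHn nb1n)).
Qed.

(** * Connected matroids have connected exchange graphs *)

(** If the fundamental circuits of the elements of [Y] stay inside [Y], then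
    [B :&: Y] is maximal independent in [Y]. A basis extending [J] by elements
    of [B] therefore has at most [#|B :&: Y|] elements in [Y], and must contain
    everything in [B :\: Y] to reach the rank. *)
Lemma union_indep B Y J : basis B -> 
  (forall f b, f \in Y -> adj B b f -> b \in Y) ->
  J \subset Y -> J \in indep M -> J :|: (B :\: Y) \in indep M.
Proof.
move=> bB closedY sJY iJ; have /andP[iB cB] := bB.
have iBY : B :&: Y \in indep M by apply: indep_sub (subsetIl _ _) iB.
have maxBY f : f \in Y -> f \notin B -> f |: (B :&: Y) \notin indep M.
  move=> fY fB; apply/negP=> iF.
  have [A [sFA sA /andP[iA cA]]] := basis_extend iF bB.
  have fA : f \in A by apply: (subsetP sFA); rewrite !inE eqxx.
  have sAB x : x \in A -> (x == f) || (x \in B).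
    move/(subsetP sA); rewrite !inE.
    by case: (x == f); case: (x \in B).
  have /subsetPn[b bB' bA] : ~~ (B \subset A).
    apply/negP=> sBA; suff: #|B| < #|A| by rewrite (eqP cA) (eqP cB) ltnn.
    apply: proper_card.
    by apply/properP; split=> //; exists f.
  have abf : adj B b f.
    apply/and3P; split=> //; suff -> : swap B b f = A by [].
    apply/esym/eqP; rewrite eqEcard card_swap // (eqP cA) (eqP cB) leqnn andbT.
    apply/subsetP=> x xA; rewrite !inE.
    case/orP: (sAB x xA) => [-> // | ->]; rewrite andbT orbC.
    by rewrite (contraNneq _ bA) // => <-.
  case/negP: bA; apply: (subsetP sFA); rewrite !inE bB' (closedY f) //.
  by rewrite orbT.
have leY I : I \subset Y -> I \in indep M -> #|I| <= #|B :&: Y|.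
  move=> sIY iI; rewrite leqNgt; apply/negP=> lt.
  have [x /setDP[xI xBY] ix] := indep_augment iBY iI lt.
  have xY := subsetP sIY x xI.
  have xB : x \notin B by move: xBY; rewrite inE xY andbT.
  by have:= maxBY x xY xB; rewrite ix.
have [A [sJA sA /andP[iA cA]]] := basis_extend iJ bB.
have sAB : A :\: Y \subset B :\: Y.
  apply/subsetP=> x; rewrite inE => /andP[xY xA]; rewrite inE xY.
  have := subsetP sA x xA; rewrite inE => /orP[xJ|//].
  by rewrite (subsetP sJY) in xY.
have eAB : A :\: Y = B :\: Y.
  apply/eqP; rewrite eqEcard sAB /= -(leq_add2l #|A :&: Y|) cardsID (eqP cA).
  rewrite -(eqP cB) -(cardsID Y B) leq_add2r leY ?subsetIr //.
  exact: indep_sub (subsetIl _ _) iA.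
apply: indep_sub iA; rewrite subUset sJA -eAB.
exact: subsetDl.
Qed.

Lemma circuit_dependent D : circuit M D -> dependent M D.
Proof. by case/minsetP. Qed.

Lemma circuit_proper D I : circuit M D -> I \proper D -> I \in indep M.
Proof.
case/minsetP=> /andP[sD _] minD pI; have sI := proper_sub pI.
apply: contraTT pI => nI.
by rewrite (minD I) ?properxx // /dependent nI (subset_trans sI).
Qed.

(** The component [Z] of [f] and its complement are both closed in the sense of
    [union_indep]. If [b] were outside [Z], a circuit [K] through [b] and [f]
    would split into proper, hence independent, parts [K :&: Z] and [K :\: Z];
    replacing first [B :\: Z] and then [B :&: Z] by these parts would make [K]
    independent. *)
Lemma reach_connected B b f : connected M -> basis B ->
  f \in ground M -> f \notin B -> b \in B -> exists n, b \in reach B f n.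
Proof.
move=> cM bB fE fB bB'.
pose R := fixset (step B f).
have RK : step B f R = R := fixsetK (@step_mono B f).
exists #|T|; rewrite -/(b \in R); apply: contraT => bR.
have sE : B \subset ground M by apply: indep_ground; case/andP: bB.
have nbf : b != f by apply: contraNneq fB => <-.
have [K [cK bK fK]] := cM _ _ (subsetP sE b bB') fE nbf.
pose Z := R :|: [set f' | (f' == f) || [exists c in R, adj B c f']].
have RB x : x \in R -> x \in B by apply: reach_in.
have adjZ x f' : adj B x f' -> (f' \in Z) = (x \in Z).
  move=> axf; have /and3P[xB f'B _] := axf.
  have -> : (x \in Z) = (x \in R).
    rewrite !inE; case: (x \in R) => //=.
    apply/negbTE; rewrite negb_or (contraNneq _ fB) => [|<- //].
    by apply/exists_inPn=> c _; rewrite /adj xB andbF.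
  have f'R : f' \in R = false by apply: contraNF f'B => /RB.
  rewrite !inE f'R /=; apply/idP/idP.
    move=> h; rewrite -RK; apply/stepP.
    case/orP: h => [/eqP <- | ]; first by left.
    by case/exists_inP=> c cR acf; right; exists f', c.
  by move=> xR; apply/orP; right; apply/exists_inP; exists x.
have fZ : f \in Z by rewrite !inE eqxx orbT.
have bZ : b \notin Z.
  rewrite !inE (negPf bR) (negPf nbf) /=.
  by apply/exists_inPn=> c _; rewrite /adj bB' andbF.
have iZ : K :&: Z \in indep M.
  apply: circuit_proper cK _; apply/properP; split; first exact: subsetIl.
  by exists b; rewrite // inE (negPf bZ) andbF.
have iZ' : K :\: Z \in indep M.
  apply: circuit_proper cK _; apply/properP; split; first exact: subsetDl.
  by exists f; rewrite // inE fZ.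
have iU : (K :\: Z) :|: (B :&: Z) \in indep M.
  have -> : B :&: Z = B :\: ~: Z by rewrite setDE setCK.
  apply: union_indep => // [f' x f'Z /adjZ e|]; last first.
    by apply/subsetP=> x; rewrite !inE => /andP[].
  by rewrite in_setC -e -in_setC.
have [A [sUA sA bA]] := basis_extend iU bB.
have AZ x : x \in Z -> (x \in A) = (x \in B).
  move=> xZ; apply/idP/idP.
    move/(subsetP sA); rewrite in_setU in_setU in_setD in_setI xZ /=.
    by rewrite andbT orbb.
  by move=> xB; apply: (subsetP sUA); rewrite in_setU !in_setI xB xZ orbT.
(* [A] is a basis containing [K :\: Z] that agrees with [B] on [Z]. *)
suff iK : (K :&: Z) :|: (A :\: Z) \in indep M.
  case/andP: (circuit_dependent cK) => _ /negP[]; apply: indep_sub iK.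
  apply/subsetP=> x xK; rewrite in_setU in_setI in_setD xK /=.
  case xZ: (x \in Z) => //=; apply: (subsetP sUA).
  by rewrite in_setU in_setD xZ xK.
apply: union_indep => //; last exact: subsetIr.
move=> f' x f'Z /and3P[xA f'A iS]; apply: contraT => xZ.
have f'B : f' \notin B by rewrite -AZ.
(* Otherwise [f'] extends [B :&: Z] independently, although [B :&: Z] spans
   [Z]. *)
have iF : f' |: (B :&: Z) \in indep M.
  apply: indep_sub iS; apply/subsetP=> y; rewrite in_setU1 in_setI in_setU1.
  case/orP=> [-> // | /andP[yB yZ]]; rewrite in_setD1 AZ // yB andbT.
  by rewrite (contraNneq _ xZ) ?orbT // => <-.
have /andP[iB cB] := bB.
have iV : (f' |: (B :&: Z)) :|: (B :\: Z) \in indep M.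
  apply: union_indep => // [g y gZ /adjZ <- //|].
  by rewrite subUset sub1set f'Z subsetIr.
have := card_indep iV.
rewrite -(eqP cB) leqNgt => /negP[]; apply: proper_card; apply/properP; split.
  apply/subsetP=> y yB; rewrite in_setU in_setU1 in_setI in_setD yB.
  by case: (y \in Z); rewrite ?orbT.
by exists f'; rewrite // in_setU in_setU1 eqxx.
Qed.

End Bases.

(** * Binary matroids mapping weakly onto a connected matroid *)

Section BinarySpace.
Variables (T : finType) (M : matroid T) (W : {set {set T}}).

(* [W] is the cycle space of a binary matroid of the same rank as [M] in which
   every basis of [M] is a basis. *)
Hypothesis W_symdiff : {in W &, forall X Y, symdiff X Y \in W}.
Hypothesis W_dep : {in W, forall X, X != set0 -> X \notin indep M}.
Hypothesis W_fund : forall B f, basis M B -> f \in ground M -> f \notin B ->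
  exists2 X, X \in W & X :\: B = [set f].
Implicit Types (B X : {set T}) (b f : T).

Lemma codeword_sub_basis X B f x : X :\: B = [set f] ->
  x \in X -> x != f -> x \in B.
Proof.
move=> XB xX nx; apply: contraTT nx => xB; rewrite negbK -in_set1 -XB.
by rewrite inE xB.
Qed.

Lemma mem_codeword X B f : X :\: B = [set f] -> f \in X.
Proof. by move=> XB; have := set11 f; rewrite -XB => /setDP[]. Qed.

Lemma adj_codeword X B b f : X \in W -> X :\: B = [set f] ->
  adj M B b f -> b \in X.
Proof.
move=> XW XB /and3P[bB fB iS]; apply: contraT => bX.
have /(W_dep XW)/negP[] : X != set0.
  by apply/set0Pn; exists f; apply: mem_codeword XB.
apply: indep_sub iS; apply/subsetP=> x xX; rewrite !inE.
case: eqP => //= /eqP nx; rewrite (codeword_sub_basis XB xX nx) andbT.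
by apply: contraNneq bX => <-.
Qed.

(** Suppose that [b f] is not an edge. The path [f - c - f1 - b] makes the
    exchange of [c, b] for [f, f1] independent in [M]. The sum of the codewords
    of [f] and [f1] avoids [b] and [c], which both codewords contain, so it lies
    inside the exchanged basis; but it is nonempty, hence dependent. *)
Lemma codeword_adj_common X B b c f f1 : basis M B -> X \in W ->
  X :\: B = [set f] -> b \in X -> adj M B c f -> adj M B c f1 ->
  adj M B b f1 -> adj M B b f.
Proof.
move=> bB XW XB bX acf acf1 abf1; apply: contraT => nabf.
have iS := adj_exchange abf1 acf nabf.
have /and3P[b_B f1B iS1] := abf1.
have f1E : f1 \in ground M.
  by apply: (subsetP (indep_ground iS1)); rewrite !inE eqxx.
have [X1 X1W X1B] := W_fund bB f1E f1B.
have nf : f != f1 by apply: contraNneq nabf => ->.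
have /(W_dep (W_symdiff XW X1W))/negP[] : symdiff X X1 != set0.
  apply/set0Pn; exists f; rewrite in_symdiff (mem_codeword XB) /=.
  apply/negP=> fX1; have := codeword_sub_basis X1B fX1 nf.
  by case/and3P: acf => _ /negPf->.
apply: indep_sub iS; apply/subsetP=> x; rewrite in_symdiff => hx.
have xb : x != b.
  by apply: contraTneq hx => ->; rewrite bX (adj_codeword X1W X1B abf1).
have xc : x != c.
  apply: contraTneq hx => ->.
  by rewrite (adj_codeword XW XB acf) (adj_codeword X1W X1B acf1).
rewrite !inE (negPf xb) (negPf xc) /=.
case: (eqVneq x f) => //= xf; case: (eqVneq x f1) => //= xf1.
case xX: (x \in X) hx => /= hx; first exact: codeword_sub_basis XB xX xf.
exact: codeword_sub_basis X1B hx xf1.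
Qed.

(** Induction on the distance from [f] to [b], for all bases at once. With
    [b - f1 - b1 - f2 - b2] the end of a shortest path to [f], the induction
    hypothesis keeps [b1] out of [X], so pivoting on [b1 f1] changes neither [X]
    nor the adjacency of [b] to [f], while it creates the edges [b f2] and
    [b2 f2]: now [b] is closer to [f]. *)
Lemma codeword_adj_reach n B X b f : basis M B -> X \in W ->
  X :\: B = [set f] -> b \in reach M B f n -> b \in X -> adj M B b f.
Proof.
elim: n => [|n IHn] in B X b f *; first by rewrite inE.
move=> bB XW XB bR bX; apply: contraT => nabf.
have /stepP[a | [f1 [b1 [abf1 b1R ab1f1]]]] := bR; first by rewrite a in nabf.
have IHb := IHn B X _ f bB XW XB.
have bRn : b \notin reach M B f n by apply: contra nabf => h; apply: IHb.
have b1X : b1 \notin X.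
  apply: contra nabf => b1X.
  exact: codeword_adj_common bB XW XB bX (IHb _ b1R b1X) ab1f1 abf1.
have nab1f : ~~ adj M B b1 f by apply: contra b1X; apply: adj_codeword XW XB.
case: n => [|n] in IHn IHb bR b1R bRn *; first by rewrite inE in b1R.
have /stepP[a|[f2 [b2 [ab1f2 b2R ab2f2]]]] := b1R; first by rewrite a in nab1f.
have nabf2 : ~~ adj M B b f2.
  by apply: contra bRn => a; apply/stepP; right; exists f2, b2.
have nab2f1 : ~~ adj M B b2 f1.
  by apply: contra bRn => a; apply/stepP; right; exists f1, b2.
have b1Rn : b1 \notin reach M B f n.
  by apply: contra bRn => a; apply/stepP; right; exists f1, b1.
have /and3P[bB' f1B _] := abf1; have /and3P[b1B _ iS] := ab1f1.
have /and3P[b2B f2B _] := ab2f2.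
have nbb1 : b != b1 by apply: contraNneq nabf2 => ->.
have nf21 : f2 != f1 by apply: contraNneq nabf2 => ->.
have nff1 : f != f1 by apply: contraNneq nabf => ->.
have fB : f \notin B by have := set11 f; rewrite -XB => /setDP[].
have nb21 : b2 != b1 by apply: contraNneq nab2f1 => ->.
pose B' := swap B b1 f1.
have bB1 : basis M B' by apply: basis_swap.
have XB' : X :\: B' = [set f].
  apply/setP=> x; rewrite -XB !inE; case xX: (x \in X);
    rewrite ?andbF // !andbT.
  have -> : x != b1 by apply: contraNneq b1X => <-.
  suff -> : (x == f1) = false by [].
  apply: contraTF (xX) => /eqP->; apply/negP=> f1X.
  by rewrite (codeword_sub_basis XB f1X) // eq_sym in f1B.
suff: adj M B' b f.
  have /andP[iB _] := bB; rewrite adj_swap // => iS2.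
  by have := nonadj_swap2 iB bB' b1B fB f1B nbb1 nff1 nabf nab1f; rewrite iS2.
apply: (IHn B' X) => //; apply/stepP; right; exists f2, b2; split.
- by rewrite adj_swap //; apply: adj_exchange.
- exact: subsetP (reach_swap b1B ab1f1 nab1f b1Rn) _ b2R.
rewrite adj_swap // /swap2 (setUC [set f2]).
exact: adj_exchange ab2f2 ab1f1 nab2f1.
Qed.

(** The codeword of [f], for a basis extending [D :\ f], is contained in the
    fundamental circuit [D] and is dependent. *)
Lemma circuit_codeword D : connected M -> circuit M D -> D \in W.
Proof.
move=> cM cD; have /andP[sD nD] := circuit_dependent cD.
have /set0Pn[f fD] : D != set0.
  by apply: contraNneq nD => ->; apply: indep_set0.
have iDf : D :\ f \in indep M by apply: circuit_proper cD (properD1 fD).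
have [B0 bB0] := basis_exists M; have [B [sB _ bB]] := basis_extend iDf bB0.
have fE := subsetP sD f fD.
have fB : f \notin B.
  apply: contra nD => fB; apply: indep_sub (_ : B \in indep M).
    by rewrite -(setD1K fD) subUset sub1set fB.
  by case/andP: bB.
have [X XW XB] := W_fund bB fE fB.
have sX : X \subset D.
  apply/subsetP=> x xX; case: (eqVneq x f) => [-> // | nx].
  have xB := codeword_sub_basis XB xX nx.
  have [n xR] := reach_connected cM bB fE fB xB.
  have /and3P[_ _ iS] := codeword_adj_reach bB XW XB xR xX.
  apply: contraR nD => xD; apply: indep_sub iS; rewrite -(setD1K fD) setUS //.
  by rewrite subsetD1 sB !inE (negPf xD) andbF.
have X0 : X != set0 by apply/set0Pn; exists f; apply: mem_codeword XB.
have /minsetP[_ minD] := cD.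
by rewrite -(minD X) // /dependent W_dep // (subset_trans sX).
Qed.

End BinarySpace.

(** * Symmetric differences and unique unions of a family *)

Section Family.
Variables (T I : finType) (C : I -> {set T}).
Implicit Types (S : {set I}).

Lemma in_big_symdiff S x :
  (x \in big_symdiff C S) = odd #|[set i in S | x \in C i]|.
Proof.
have -> : #|[set i in S | x \in C i]| = \sum_(i in S) (x \in C i).
  rewrite -sum1_card; under eq_bigl do rewrite inE.
  by rewrite big_mkcondr; apply: eq_bigr => i _; case: (x \in C i).
rewrite /big_symdiff.
apply: (big_rec2 (fun (A : {set T}) n => (x \in A) = odd n)) => [|i A n _ IH].
  by rewrite inE.
by rewrite in_symdiff oddD IH; case: (x \in C i).
Qed.

Lemma unique_union_sub S : unique_union C S \subset big_symdiff C S.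
Proof. by apply/subsetP=> x; rewrite inE in_big_symdiff => /eqP->. Qed.

Lemma big_symdiff_symdiff S S' :
  big_symdiff C (symdiff S S') = symdiff (big_symdiff C S) (big_symdiff C S').
Proof.
apply/setP=> x; rewrite in_symdiff !in_big_symdiff -oddD.
set A := finset _; set A' := finset _; set A2 := finset _.
have -> : A = symdiff A' A2.
  apply/setP=> i; rewrite !inE.
  by case: (i \in S); case: (i \in S'); case: (x \in C i).
rewrite /symdiff cardsU disjoint_setI0; last first.
  rewrite -setI_eq0; apply/eqP/setP=> i; rewrite in_setI !in_setD in_set0.
  by case: (i \in A'); rewrite ?andbF.
rewrite cards0 subn0 -(cardsID A2 A') -(cardsID A' A2) (setIC A2) !oddD.
by case: (odd _); case: (odd _); case: (odd _).
Qed.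

Lemma symdiff_eq0 (A B : {set I}) : symdiff A B = set0 -> A = B.
Proof.
move/setP=> E; apply/setP=> x; have := E x; rewrite in_symdiff inE.
by case: (x \in A); case: (x \in B).
Qed.

End Family.

(** * The span of a circuit system *)

Section System.
Variables (T : finType) (M : matroid T) (C : 'I_(corank M) -> {set T}).
Hypothesis C_dep :
  forall S : {set 'I_(corank M)}, S != set0 -> dependent M (unique_union C S).
Hypothesis C_ground : forall i, C i \subset ground M.

Lemma big_symdiff_dependent S : S != set0 -> big_symdiff C S \notin indep M.
Proof.
move/C_dep=> /andP[_]; apply: contra; apply: indep_sub.
exact: unique_union_sub.
Qed.

Lemma big_symdiff0 : big_symdiff C set0 = set0.
Proof. by rewrite /big_symdiff big_set0. Qed.

Lemma big_symdiff_ground S : big_symdiff C S \subset ground M.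
Proof.
apply/subsetP=> x; rewrite in_big_symdiff => /odd_gt0/card_gt0P[i].
by rewrite inE => /andP[_]; apply/subsetP.
Qed.

(** If two symmetric differences agree outside [B], then their sum is again one,
    contained in the independent set [B], so the index sets coincide. *)
Lemma big_symdiff_cobasis_inj B : basis M B ->
  injective (fun S => big_symdiff C S :\: B).
Proof.
move=> /andP[iB _] S S' /= E; apply: symdiff_eq0; apply/eqP; apply: contraT.
move=> /big_symdiff_dependent/negP[]; apply: indep_sub iB.
rewrite big_symdiff_symdiff; apply/subsetP=> x; rewrite in_symdiff => hx.
apply: contraT => xB; move/setP/(_ x): E; rewrite !in_setD xB /= => E.
by rewrite E addbb in hx.
Qed.

(** The complement of [B] has as many elements as there are indices, so the
    injection of [big_symdiff_cobasis_inj] is onto its power set. *)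
Lemma big_symdiff_fund B f : basis M B -> f \in ground M -> f \notin B ->
  exists S, big_symdiff C S :\: B = [set f].
Proof.
move=> bB fE fB; pose phi S := big_symdiff C S :\: B.
have inj := big_symdiff_cobasis_inj bB.
suff /imsetP[S _ ->] : [set f] \in phi @: [set: {set 'I_(corank M)}].
  by exists S.
suff -> : phi @: [set: {set 'I_(corank M)}] = powerset (ground M :\: B).
  by rewrite powersetE sub1set inE fE fB.
apply/eqP; rewrite eqEcard card_imset // card_powerset card_cobasis //.
rewrite -powersetT card_powerset cardsT card_ord leqnn andbT.
apply/subsetP=> _ /imsetP[S _ ->]; rewrite powersetE.
exact: setSD (big_symdiff_ground S).
Qed.

Lemma big_symdiff_inj : injective (big_symdiff C).
Proof.
have [B bB] := basis_exists M; move=> S S' E.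
by apply: (big_symdiff_cobasis_inj bB); rewrite /= E.
Qed.

Lemma circuit_big_symdiff D : connected M -> circuit M D ->
  exists S, D = big_symdiff C S.
Proof.
move=> cM cD; suff /imsetP[S _ ->] : D \in big_symdiff C @: setT by exists S.
apply: circuit_codeword cM cD.
- move=> _ _ /imsetP[S _ ->] /imsetP[S' _ ->]; rewrite -big_symdiff_symdiff.
  exact: imset_f.
- move=> _ /imsetP[S _ ->] n0; apply: big_symdiff_dependent.
  by apply: contraNneq n0 => ->; rewrite big_symdiff0.
move=> B f bB fE fB; have [S E] := big_symdiff_fund bB fE fB.
by exists (big_symdiff C S) => //; apply: imset_f.
Qed.

End System.

Theorem corollary4p5 (T : finType) (M : matroid T)
    (C : 'I_(corank M) -> {set T}) (D : {set T})
    (M_connected : connected M) (C_system : circuit_system C)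
    (D_circuit : circuit M D) :
  exists! S : {set 'I_(corank M)},
    D = big_symdiff C S /\ big_symdiff C S = unique_union C S.
Proof.
have [[_ C_dep] C_circ] := C_system.
have C_ground i : C i \subset ground M.
  by case/andP: (circuit_dependent (C_circ i)).
have [S DS] := circuit_big_symdiff C_dep C_ground M_connected D_circuit.
exists S; split=> [|S' [DS' _]]; last first.
  by apply: (big_symdiff_inj C_dep); rewrite -DS.
split=> //; rewrite -DS; have /minsetP[_ minD] := D_circuit.
apply/esym/minD; last by rewrite DS unique_union_sub.
apply: C_dep; apply: contraTneq (circuit_dependent D_circuit) => S0.
by rewrite DS S0 big_symdiff0 /dependent indep_set0 andbF.
Qed.
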